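(* Let $p$ be a prime, $a$ a complex number, and for a finite abelian group $F$ let $\sigma_a(F)=\sum_{H\le F}|H|^a$ (sum over all subgroups $H$ of $F$). Let $F_r$ be a finite abelian $p$-group of rank $r\ge1$ and exponent $p^\ell$. Let $e_\ell\in F_r$ be an element of order $p^\ell$ and let $F_{r-1}$ be a subgroup of $F_r$ such that $F_r=F_{r-1}\oplus\mathbb{Z}e_\ell$. Then $$(p^a-1)\,\sigma_a(F_r)=p^{a\ell+a}\,|F_{r-1}|\,\sigma_{a-1}(F_{r-1})-\sigma_{a+1}(F_{r-1}).$$ *)

(* Defs.v *)
From mathcomp Require Import all_boot all_order all_algebra all_fingroup.
From mathcomp Require Import all_solvable.
From mathcomp Require Import complex reals sequences exp trigo.

Set Implicit Arguments.
Unset Strict Implicit.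
Unset Printing Implicit Defensive.

Local Open Scope ring_scope.
Local Open Scope complex_scope.

Definition cexp (R : realType) (z : R[i]) : R[i] :=
  (expR (Re z))%:C * (cos (Im z) +i* sin (Im z)).

(* n ^ a = exp (a log n) with the real logarithm of n > 0; since ln 0 = 0 in
   the library, the value at n = 0 is the irrelevant 1. *)
Definition natCpow (R : realType) (n : nat) (a : R[i]) : R[i] :=
  cexp (a * (ln (n%:R : R))%:C).

Definition sigma (R : realType) (gT : finGroupType) (a : R[i])
    (F : {group gT}) : R[i] :=
  \sum_(H in subgroups F) natCpow #|H| a.

(* Main.v *)
Require Import Defs.
From mathcomp Require Import all_boot all_order all_algebra all_fingroup.
From mathcomp Require Import all_solvable all_field.
From mathcomp Require Import complex reals sequences exp trigo.
From mathcomp Require Import ring.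

(* For a subgroup K of F', the subgroups H of F with H :&: F' = K correspond to
   the pairs (y, i) with y in F' / K, i <= l and #[y] %| p ^ i, through
   H / K = <y * e ^ (p ^ (l - i))>; such an H has order #|K| * p ^ i.
   Multiplying the geometric sum over i by p ^ a - 1 leaves
     p ^ (a l + a) * #|K| ^ a - (#|K| * #[y]) ^ a.
   The first terms add up to p ^ (a l + a) * #|F'| * sigma (a - 1) F'. In the
   second ones, #|K| * #[y] is the order of the preimage L of <y>, and each L
   arises from exactly #|L| pairs (K, y). By induction on L this last count
   amounts to \sum_(K <= L) #|L : K| = \sum_(K <= L) #|K|, which holds because
   L carries a perfect symmetric pairing with values in the roots of unity. *)

Set Implicit Arguments.
Unset Strict Implicit.
Unset Printing Implicit Defensive.

Import Order.TTheory GRing.Theory Num.Theory.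

Local Open Scope group_scope.

(** * Perfect symmetric pairings on finite abelian groups *)

(** The first clause excludes the zero map, which satisfies the other three. With it, finite orders
    force the values to be roots of unity, and symmetry gives multiplicativity in the first
    argument. *)
Definition perfect_pairing (gT : finGroupType) (G : {set gT})
    (b : gT -> gT -> algC) : Prop :=
  [/\ {in G, forall x, b x 1 = 1%R},
      {in G & &, forall x y z, b x (y * z)%g = (b x y * b x z)%R},
      {in G &, forall x y, b x y = b y x} &
      {in G, forall x, {in G, forall y, b x y = 1%R} -> x = 1}].

(** The pairing sends [(x ^+ i, x ^+ j)] to [z ^+ (i * j)], with [z] a primitive root of unity of
    order [#[x]]. *)
Lemma perfect_pairing_cycle (gT : finGroupType) (x : gT) :
  exists b, perfect_pairing <[x]> b.
Proof.
have [z zP] := C_prim_root_exists (order_gt0 x).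
(* Discrete logarithm to base [x], with default 0 outside [<[x]>]. *)
pose lg g := if [pick i : 'I_#[x] | x ^+ i == g] is Some i then val i else 0%N.
have lgK g : g \in <[x]> -> x ^+ lg g = g.
  case/cyclePmin=> i lti ->; rewrite /lg; case: pickP => [j /eqP //|].
  by move/(_ (Ordinal lti)); rewrite eqxx.
exists (fun g h => z ^+ (lg g * lg h))%R; split.
- move=> g gx; apply/eqP; rewrite -(prim_order_dvd zP) dvdn_mull //.
  by rewrite order_dvdn lgK ?group1.
- move=> u g h ux gx hx; rewrite -GRing.exprD -mulnDr.
  apply/eqP; rewrite (eq_prim_root_expr zP).
  have: (lg (g * h)%g == lg g + lg h %[mod #[x]])%N.
    by rewrite -eq_expg_mod_order lgK ?groupM // expgD !lgK.
  by move/eqP=> E; rewrite -modnMmr E modnMmr.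
- by move=> g h _ _; rewrite mulnC.
move=> g gx /(_ x (cycle_id x))/eqP; rewrite -(prim_order_dvd zP) => dv.
(* Only a congruence: [lg x] is 0 when [x] is trivial. *)
have: (lg x == 1 %[mod #[x]])%N by rewrite -eq_expg_mod_order lgK ?cycle_id.
move/eqP=> E; move: dv; rewrite /dvdn -modnMmr E modnMmr muln1 => /eqP dv.
by apply/eqP; rewrite -(lgK g gx) -order_dvdn; apply/eqP.
Qed.

(** Multiply the pairings of the components; [divgr] and [remgr] are the two projections.
    Nondegeneracy is tested on each factor separately. *)
Lemma perfect_pairing_dprod (gT : finGroupType) (H K G : {group gT})
    (b c : gT -> gT -> algC) :
    H \x K = G -> perfect_pairing H b -> perfect_pairing K c ->
  exists d, perfect_pairing G d.
Proof.
case/dprodP=> _ defG cHK tiHK [b_1 bM bC b1] [c_1 cM cC c1].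
exists (fun x y => b (divgr H K x) (divgr H K y)
                 * c (remgr H K x) (remgr H K y))%R.
have dP x : x \in G -> divgr H K x \in H by rewrite -defG; apply: mem_divgr.
have rP x : x \in G -> remgr H K x \in K by rewrite -defG; apply: mem_remgr.
have xyE x y : x \in G -> y \in G ->
    x * y = (divgr H K x * divgr H K y) * (remgr H K x * remgr H K y).
  move=> Gx Gy; rewrite {1}(divgr_eq H K x) {1}(divgr_eq H K y).
  move: (divgr H K y) (remgr H K x) (dP y Gy) (rP x Gx) => d r Hd Kr.
  move: (divgr H K x) (remgr H K y) => d' r'.
  have rd : r * d = d * r := centP (subsetP cHK _ Kr) _ Hd.
  by rewrite -!mulgA; congr (_ * _); rewrite !mulgA rd.
have d1 : divgr H K 1 = 1 by rewrite -[X in divgr _ _ X]mulg1 divgrMid.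
have r1 : remgr H K 1 = 1 by rewrite -[X in remgr _ _ X]mulg1 remgrMid.
split.
- by move=> x Gx; rewrite d1 r1 b_1 ?c_1 ?dP ?rP // mulr1.
- move=> u x y Gu Gx Gy.
  have [Hx Hy Kx Ky] := And4 (dP x Gx) (dP y Gy) (rP x Gx) (rP y Gy).
  have [Hxy Kxy] := (groupM Hx Hy, groupM Kx Ky).
  rewrite xyE // (divgrMid tiHK Hxy Kxy) (remgrMid tiHK Hxy Kxy).
  by rewrite bM ?dP // cM ?rP // mulrACA.
- by move=> x y Gx Gy; rewrite bC ?dP // cC ?rP.
move=> x Gx xP.
have dx1 : divgr H K x = 1.
  apply: (b1 _ (dP x Gx)) => y Hy.
  have Gy1 : y * 1 \in G by rewrite -defG mem_mulg.
  have := xP _ Gy1; rewrite (divgrMid tiHK Hy (group1 K)).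
  by rewrite (remgrMid tiHK Hy (group1 K)) (c_1 _ (rP x Gx)) mulr1.
have rx1 : remgr H K x = 1.
  apply: (c1 _ (rP x Gx)) => y Ky.
  have Gy1 : 1 * y \in G by rewrite -defG mem_mulg.
  have := xP _ Gy1; rewrite (divgrMid tiHK (group1 H) Ky).
  by rewrite (remgrMid tiHK (group1 H) Ky) (b_1 _ (dP x Gx)) mul1r.
have xE := divgr_eq H K x.
by rewrite dx1 rx1 mulg1 in xE.
Qed.

Lemma perfect_pairing_exists (gT : finGroupType) (G : {group gT}) :
  abelian G -> exists b, perfect_pairing G b.
Proof.
case/abelian_structure=> s defG _.
elim: s G defG => [|x s IHs] G; rewrite (big_nil, big_cons).
  move=> <-; exists (fun _ _ => 1%R); split=> //.
  - by move=> *; rewrite mulr1.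
  - by move=> x /set1P.
move=> defG; case/dprodP: (defG) => [[_ K _ defK] _ _ _].
rewrite defK in defG.
have [b bP] := perfect_pairing_cycle x; have [c cP] := IHs _ defK.
exact: perfect_pairing_dprod defG bP cP.
Qed.

(** * Annihilators and the duality of subgroups *)

Definition annihilator (gT : finGroupType) (G M : {set gT})
    (b : gT -> gT -> algC) : {set gT} :=
  [set x in G | [forall y in M, b x y == 1%R]].

Lemma annihilatorP (gT : finGroupType) (G M : {set gT})
    (b : gT -> gT -> algC) (x : gT) :
  reflect (x \in G /\ {in M, forall y, b x y = 1%R})
          (x \in annihilator G M b).
Proof.
rewrite inE; apply: (iffP andP) => -[Gx xP]; split=> //.
  by move=> y My; apply/eqP; apply: (forall_inP xP).
by apply/forall_inP=> y My; rewrite xP.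
Qed.

Lemma group_set_annihilator (gT : finGroupType) (G M : {group gT})
    (b : gT -> gT -> algC) :
  perfect_pairing G b -> M \subset G -> group_set (annihilator G M b).
Proof.
case=> b1 bM bC _ /subsetP sMG; apply/group_setP; split.
  by apply/annihilatorP; split=> // y My; rewrite bC ?b1 ?sMG.
move=> x y /annihilatorP[Gx xP] /annihilatorP[Gy yP].
apply/annihilatorP; split=> [|z Mz]; first exact: groupM.
have Gz := sMG z Mz; have Gxy := groupM Gx Gy.
by rewrite (bC _ _ Gxy Gz) bM // (bC _ _ Gz Gx) (bC _ _ Gz Gy) xP ?yP ?mulr1.
Qed.

(** Orthogonality of characters: if [b x z != 1] for some [z] in [M], translating by [z] multiplies
    the sum by [b x z], so it vanishes. *)
Lemma sum_pairing (gT : finGroupType) (G M : {group gT})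
    (b : gT -> gT -> algC) (x : gT) :
    perfect_pairing G b -> M \subset G -> x \in G ->
  (\sum_(y in M) b x y = (x \in annihilator G M b)%:R * #|M|%:R)%R.
Proof.
case=> b1 bM bC _ /subsetP sMG Gx.
have [/annihilatorP[_ xP]|] := boolP (x \in _).
  by rewrite mul1r (eq_bigr _ xP) sumr_const.
rewrite inE Gx negb_forall_in => /exists_inP[z Mz bz]; rewrite mul0r.
apply: (mulfI (_ : b x z - 1 != 0)%R); first by rewrite subr_eq0.
apply/eqP; rewrite mulr0 mulrBl mul1r subr_eq0 mulr_sumr; apply/eqP.
rewrite [RHS](reindex_inj (mulgI z)); apply: eq_big => y.
  by rewrite groupMl.
by move=> My; have Gy := sMG y My; have Gz := sMG z Mz; rewrite bM.
Qed.

(** Evaluate the sum of [b x y] over [G] and [M] in both orders. When [x] is summed first,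
    nondegeneracy leaves only [y = 1], which contributes [#|G|]. *)
Lemma card_annihilator (gT : finGroupType) (G M : {group gT})
    (b : gT -> gT -> algC) :
  perfect_pairing G b -> M \subset G -> (#|annihilator G M b| * #|M| = #|G|)%N.
Proof.
move=> bP sMG; have [b1 bM bC bnd] := bP.
apply/eqP; rewrite -(eqr_nat algC) natrM; apply/eqP.
transitivity (\sum_(x in G) \sum_(y in M) b x y)%R.
  rewrite (eq_bigr _ (fun x Gx => sum_pairing bP sMG Gx)) -mulr_suml.
  rewrite -natr_sum -sum1_card -big_mkcondr; congr (_%:R * _)%R.
  by apply: eq_bigl => x; rewrite inE; case: (x \in G).
rewrite exchange_big /= (bigD1 1) //= [X in (_ + X)%R]big1 => [|y /andP[My y1]].
  by rewrite addr0 (eq_bigr _ b1) sumr_const.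
have Gy := subsetP sMG y My.
rewrite (eq_bigr (b y)) => [|x Gx]; last by rewrite bC.
rewrite (sum_pairing bP (subxx G) Gy).
case: annihilatorP => [[_ /(bnd _ Gy) y_1]|_]; last by rewrite mul0r.
by rewrite y_1 eqxx in y1.
Qed.

(** Symmetry gives one inclusion, and [card_annihilator] applied twice gives equal orders. *)
Lemma annihilatorK (gT : finGroupType) (G M : {group gT})
    (b : gT -> gT -> algC) :
  perfect_pairing G b -> M \subset G ->
  annihilator G (annihilator G M b) b = M.
Proof.
move=> bP sMG; have [_ _ bC _] := bP.
pose A := Group (group_set_annihilator bP sMG).
have sAG : A \subset G by apply/subsetP=> x /annihilatorP[].
apply/esym/eqP; rewrite eqEcard; apply/andP; split.
  apply/subsetP=> x Mx; have Gx := subsetP sMG x Mx.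
  apply/annihilatorP; split=> // y /annihilatorP[Gy yP].
  by rewrite bC ?yP.
rewrite -(leq_pmul2r (cardG_gt0 A)) (card_annihilator bP sAG).
by rewrite mulnC (card_annihilator bP sMG).
Qed.

(** Taking annihilators is an involution on the subgroups of [G] that exchanges order and index. *)
Lemma sum_subgroups_index (gT : finGroupType) (G : {group gT}) :
    abelian G ->
  (\sum_(K in subgroups G) #|G : K| = \sum_(K in subgroups G) #|K|)%N.
Proof.
case/perfect_pairing_exists=> b bP.
pose ann (M : {group gT}) := <<annihilator G M b>>%G.
have annE (M : {group gT}) : M \subset G ->
    ann M = annihilator G M b :> {set _}.
  move=> sMG.
  by rewrite /= (gen_set_id (group_set_annihilator bP sMG)).
have annS (M : {group gT}) : M \subset G -> ann M \subset G.
  by move=> sMG; rewrite annE //; apply/subsetP=> x /annihilatorP[].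
have annK (M : {group gT}) : M \subset G -> ann (ann M) = M.
  move=> sMG; apply/val_inj; rewrite /= -/(val (ann (ann M))).
  by rewrite annE ?annS // annE // annihilatorK.
rewrite (reindex_onto ann ann) => [|M]; last by rewrite inE; apply: annK.
apply: eq_big => [M|M /andP[]]; rewrite !inE.
  apply/andP/idP => [[sMG /eqP <-]|sMG]; first exact: annS.
  by rewrite annS ?annK.
move=> sAG /eqP annM; have sMG : M \subset G by rewrite -annM annS.
apply/eqP; rewrite -(eqn_pmul2l (cardG_gt0 (ann M))) Lagrange //.
by rewrite annE ?card_annihilator.
Qed.

(** * Pairs of a subgroup and an element of the quotient by it *)

(** For [K] normal in [L] these are the generators of the quotient [L / K]; otherwise the set is
    empty. *)
Definition cyclic_extension_gens (gT : finGroupType) (K L : {group gT}) :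
    {set coset_of K} :=
  [set y : coset_of K | (coset K @*^-1 <[y]>)%G == L].

Lemma sum_quotient_cyclic_extension (V : nmodType) (gT : finGroupType)
    (G K : {group gT}) (f : nat -> V) :
    abelian G -> K \subset G ->
  (\sum_(y in (G / K)%g) f (#|K| * #[y])%N
   = \sum_(L in subgroups G) f #|L| *+ #|cyclic_extension_gens K L|)%R.
Proof.
move=> abG sKG; have nKG : K <| G by rewrite -sub_abelian_normal.
rewrite (partition_big (fun y => coset K @*^-1 <[y]>)%G (mem (subgroups G))) /=.
  apply: eq_bigr => L; rewrite inE => sLG; rewrite -sumr_const.
  apply: eq_big => [y|y /andP[_ /eqP <-]]; last by rewrite card_cosetpre.
  rewrite inE andb_idl // => /eqP defL.
  by move: sLG; rewrite -defL /= sub_cosetpre_quo // cycle_subG.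
by move=> y Gy; rewrite inE /= sub_cosetpre_quo // cycle_subG.
Qed.

Lemma sum_cyclic_extension_gens_sub (gT : finGroupType) (G L : {group gT}) :
    L \subset G ->
  (\sum_(K in subgroups G) #|cyclic_extension_gens K L|
   = \sum_(K in subgroups L) #|cyclic_extension_gens K L|)%N.
Proof.
move=> sLG; rewrite (bigID (mem (subgroups L))) /= [X in (_ + X)%N]big1 ?addn0.
  apply: eq_bigl => K; rewrite !inE andb_idl // => sKL.
  exact: subset_trans sLG.
move=> K /andP[_]; rewrite inE => nsKL.
apply/eqP; rewrite cards_eq0; apply/set0Pn=> -[y]; rewrite inE => /eqP defL.
by case/negP: nsKL; rewrite -defL sub_cosetpre.
Qed.

(* Summed over all subgroups of L, both sides give the number of pairs (K, y)
   with K <= L and y in L / K, the right one by duality; induction isolates the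
   summand of L itself. *)
Lemma sum_cyclic_extension_gens (gT : finGroupType) (L : {group gT}) :
    abelian L ->
  (\sum_(K in subgroups L) #|cyclic_extension_gens K L| = #|L|)%N.
Proof.
have [n] := ubnP #|L|; elim: n L => // n IHn L /ltnSE leLn abL.
have LL : L \in subgroups L by rewrite inE.
have : (\sum_(M in subgroups L) \sum_(K in subgroups M)
          #|cyclic_extension_gens K M| = \sum_(M in subgroups L) #|M|)%N.
  rewrite -sum_subgroups_index //.
  transitivity (\sum_(M in subgroups L) \sum_(K in subgroups L)
          #|cyclic_extension_gens K M|)%N.
    apply: eq_bigr => M; rewrite inE => sML.
    by rewrite (sum_cyclic_extension_gens_sub sML).
  rewrite exchange_big; apply: eq_bigr => K; rewrite inE => sKL.
  have nKL : K <| L by rewrite -sub_abelian_normal.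
  rewrite -card_quotient ?normal_norm // -sum1_card.
  have := sum_quotient_cyclic_extension (fun=> 1%N) abL sKL.
  by move=> /= ->; apply: eq_bigr => M _; rewrite -[LHS]natn.
rewrite (bigD1 L) // [RHS](bigD1 L) //=.
rewrite [X in (_ + X)%N = _](eq_bigr (fun M : {group gT} => #|M|)).
  by move/addIn.
move=> M /andP[]; rewrite inE => sML neML.
apply: IHn (abelianS sML abL); apply: leq_trans leLn.
by rewrite proper_card // properEneq neML.
Qed.

(** For [f n] equal to [n ^ a], the right side is [sigma (a + 1) G]. *)
Lemma sum_subgroups_quotient (V : nmodType) (gT : finGroupType)
    (G : {group gT}) (f : nat -> V) :
    abelian G ->
  (\sum_(K in subgroups G) \sum_(y in (G / K)%g) f (#|K| * #[y])%N
   = \sum_(L in subgroups G) f #|L| *+ #|L|)%R.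
Proof.
move=> abG.
transitivity (\sum_(K in subgroups G) \sum_(L in subgroups G)
    f #|L| *+ #|cyclic_extension_gens K L|)%R.
  apply: eq_bigr => K; rewrite inE => sKG.
  exact: sum_quotient_cyclic_extension.
rewrite exchange_big; apply: eq_bigr => L; rewrite inE => sLG.
rewrite sumrMnr sum_cyclic_extension_gens_sub //.
by rewrite sum_cyclic_extension_gens // (abelianS sLG).
Qed.

(** * Subgroups of a direct product with a cyclic factor *)

Lemma subgroup_cycle_pgroup (gT : finGroupType) (p l : nat) (e : gT)
    (B : {group gT}) :
    prime p -> #[e] = (p ^ l)%N -> B \subset <[e]> ->
  exists2 i, (i <= l)%N & B = <[e ^+ (p ^ (l - i))]>%G.
Proof.
move=> p_pr oe sBe; have := cardSg sBe; rewrite -orderE oe.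
case/(dvdn_pfactor _ _ p_pr) => i le_il oB; exists i => //.
have dv : (p ^ i %| #[e])%N by rewrite oe dvdn_exp2l.
have /setP/(_ B) := cycle_sub_group dv.
by rewrite !inE sBe oB eqxx oe -expnB ?prime_gt0 // => /esym/eqP.
Qed.

Lemma order_expg_pgroup (gT : finGroupType) (p l i : nat) (e : gT) :
    prime p -> #[e] = (p ^ l)%N -> (i <= l)%N ->
  #[e ^+ (p ^ (l - i))] = (p ^ i)%N.
Proof.
move=> p_pr oe le_il.
rewrite orderXdiv oe ?dvdn_exp2l ?leq_subr // -expnB ?prime_gt0 ?leq_subr //.
by rewrite subKn.
Qed.

(** Projection to [<[e]>] is injective on such an [H], so [H] is the graph of a homomorphism to [A]
    from the subgroup of [<[e]>] of some order [p ^ i]. The image [y] of a generator can be any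
    element of [A] of order dividing [p ^ i]. *)
Lemma sum_subgroups_trivial_meet (V : nmodType) (gT : finGroupType) (p l : nat)
    (G A : {group gT}) (e : gT) (f : nat -> V) :
    prime p -> abelian G -> #[e] = (p ^ l)%N -> A \x <[e]> = G ->
  (\sum_(H in subgroups G | H :&: A == 1%g) f #|H|
   = \sum_(y in A) \sum_(i < l.+1 | (#[y] %| p ^ i)%N) f (p ^ i)%N)%R.
Proof.
move=> p_pr abG oe /dprodP[_ defG _ tiAe].
have sAG : A \subset G by rewrite -defG mulG_subl.
have Ge : e \in G by rewrite -cycle_subG -defG mulG_subr.
pose c i := e ^+ (p ^ (l - i)).
have Gc i : c i \in G by rewrite groupX.
have tiA u : u \in A -> u \in <[e]> -> u = 1.
  by move=> Au eu; apply/set1gP; rewrite -tiAe inE Au.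
have ycX y i k : y \in A -> (y * c i) ^+ k = y ^+ k * c i ^+ k.
  move=> Ay; rewrite expgMn //; apply: (centsP abG); last exact: Gc.
  exact: (subsetP sAG).
(* The [<[e]>]-component of the power is [c i ^+ k], and it must vanish. *)
have ycA y i k : (i <= l)%N -> y \in A -> (y * c i) ^+ k \in A ->
    (p ^ i %| k)%N.
  move=> le_il Ay; rewrite ycX // (groupMl _ (groupX k Ay)) => Ack.
  rewrite -(order_expg_pgroup p_pr oe le_il) order_dvdn.
  by apply/eqP/tiA; rewrite // !groupX ?cycle_id.
have oyc y i : (i <= l)%N -> y \in A -> (#[y] %| p ^ i)%N ->
    #[y * c i] = (p ^ i)%N.
  move=> le_il Ay dvy; apply/eqP; rewrite eqn_dvd; apply/andP; split.
    rewrite order_dvdn ycX //; move: dvy; rewrite order_dvdn => /eqP->.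
    by rewrite mul1g -order_dvdn order_expg_pgroup.
  by rewrite (@ycA y) // expg_order.
rewrite pair_big_dep /=.
pose E := [set u : gT * 'I_l.+1 | (u.1 \in A) && (#[u.1] %| p ^ u.2)%N].
pose h (u : gT * 'I_l.+1) := <[u.1 * c u.2]>%G.
transitivity (\sum_(u in E) f #|h u|)%R; last first.
  apply: eq_big => [u|[y i]]; rewrite inE //= => /andP[Ay dvy].
  by rewrite -orderE oyc // -ltnS.
rewrite -(@big_imset _ _ _ _ _ h (mem E) (fun H : {group gT} => f #|H|)) /=;
    last first.
  move=> [y i] [y' i']; rewrite !inE /= => /andP[Ay dvy] /andP[Ay' dvy'] eqh.
  have [le_il le_i'l] : (i <= l)%N /\ (i' <= l)%N by split; rewrite -ltnS.
  have eq_i : i = i'.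
    apply/val_inj/eqP; rewrite /= -(eqn_exp2l _ _ (prime_gt1 p_pr)).
    rewrite -(oyc y) // -(oyc y') // !orderE.
    by rewrite (congr1 val eqh : <[_]> = <[_]>).
  subst i'; congr (_, _).
  (* Write [y' * c i] as the [k]-th power of [y * c i]. Comparing components gives [y' = y ^+ k] and
     [k = 1] modulo [p ^ i], hence modulo [#[y]]. *)
  have : y' * c i \in <[y * c i]>.
    by rewrite (congr1 val eqh : <[_]> = <[_]>) cycle_id.
  case/cycleP=> k; rewrite ycX // => eqk.
  have [Gy Gy'] := (subsetP sAG y Ay, subsetP sAG y' Ay').
  have E1 : (y ^+ k)^-1 * y' = c i ^+ k * (c i)^-1.
    by apply: (mulIg (c i)); rewrite mulgKV -mulgA eqk mulKg.
  have E2 : (y ^+ k)^-1 * y' = 1.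
    apply: tiA; first by rewrite groupM ?groupV ?groupX.
    by rewrite E1 groupM ?groupV ?groupX ?cycle_id.
  have y'E : y' = y ^+ k by rewrite -[RHS]mulg1 -E2 mulKVg.
  have ck : c i ^+ k = c i ^+ 1.
    by apply/eqP; rewrite expg1 eq_mulgV1 -E1 E2.
  rewrite y'E -[LHS]expg1; apply/eqP; rewrite eq_expg_mod_order.
  move/eqP: ck; rewrite eq_expg_mod_order order_expg_pgroup // => /eqP ck.
  by rewrite -(modn_dvdm k dvy) ck modn_dvdm.
apply: eq_bigl => H; rewrite inE.
apply/andP/imsetP => [[sHG /eqP tiHA]|]; last first.
  case=> -[y i]; rewrite inE /= => /andP[Ay dvy] ->; split.
    by rewrite cycle_subG; apply: groupM (subsetP sAG y Ay) (Gc i).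
  rewrite -subG1; apply/subsetP=> u /setIP[/cycleP[k ->] Ak].
  have le_il : (i <= l)%N by rewrite -ltnS.
  have := ycA y i k le_il Ay Ak.
  by rewrite -(oyc y) // order_dvdn => /eqP->; rewrite inE.
(* [A <*> H] meets [<[e]>] in the projection of [H], which is therefore generated by some [c i]; an
   element [g] of [H] above [c i] then supplies [y]. *)
have [|i le_il defB] :=
  subgroup_cycle_pgroup (B := (A <*> H) :&: <[e]>)%G p_pr oe.
  exact: subsetIr.
have {}defB : (A <*> H) :&: <[e]> = <[c i]> := congr1 val defB.
have AHE : A <*> H = A * H.
  by rewrite norm_joinEr // (subset_trans sHG) // sub_abelian_norm.
have : c i \in <[c i]> by apply: cycle_id.
rewrite -defB inE AHE => /andP[/mulsgP[y' g Ay' Hg ci] _].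
pose y := y'^-1; have Ay : y \in A by rewrite groupV.
have gE : g = y * c i by rewrite ci mulKg.
have tiH u : u \in H -> u \in A -> u = 1.
  by move=> Hu Au; apply/set1gP; rewrite -tiHA inE Hu.
have lt_il : (i < l.+1)%N by rewrite ltnS.
exists (y, Ordinal lt_il).
  rewrite inE /= Ay order_dvdn; apply/eqP/tiH; last by rewrite groupX.
  have : g ^+ (p ^ i) \in H by rewrite groupX.
  rewrite gE ycX //.
  have /eqP-> : c i ^+ (p ^ i) == 1 by rewrite -order_dvdn order_expg_pgroup.
  by rewrite mulg1.
apply/val_inj/eqP; rewrite /= -gE eqEsubset cycle_subG Hg andbT.
apply/subsetP=> x Hx.
(* The [<[e]>]-component of [x] is a power [c i ^+ k], so [x] and [g ^+ k] differ by an element of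
   [H] and [A], which is trivial. *)
have := subsetP sHG x Hx; rewrite -defG => /mulsgP[u v Au ev xE].
have : v \in <[c i]>.
  rewrite -defB inE ev andbT AHE; apply/mulsgP.
  by exists u^-1 x; rewrite ?groupV // xE mulKg.
case/cycleP=> k vE; suff -> : x = g ^+ k by apply: mem_cycle.
apply/eqP; rewrite eq_mulgV1; apply/eqP/tiH.
  by rewrite groupM ?groupV ?groupX.
rewrite xE vE gE ycX // invMg mulgA mulgK groupM // groupV groupX //.
Qed.

(** Since [K] lies in [A], it meets [<[e]>] trivially, so [<[e]>] maps isomorphically to the
    quotient. *)
Lemma quotient_dprod_cycle (gT : finGroupType) (G A K : {group gT}) (e : gT) :
    abelian G -> A \x <[e]> = G -> K \subset A ->
  A / K \x <[coset K e]> = G / K /\ #[coset K e] = #[e].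
Proof.
move=> abG /dprodP[_ defG cAe tiAe] sKA.
have sAG : A \subset G by rewrite -defG mulG_subl.
have Ge : e \in G by rewrite -cycle_subG -defG mulG_subr.
have sKG := subset_trans sKA sAG.
have nKG : G \subset 'N(K) by rewrite sub_abelian_norm.
have nKe : <[e]> \subset 'N(K) by rewrite cycle_subG (subsetP nKG).
have eqe : <[coset K e]> = <[e]> / K.
  by rewrite quotient_cycle // -cycle_subG.
split.
  rewrite eqe dprodE ?quotient_cents //.
    by rewrite -defG quotientMl // (subset_trans sAG).
  by rewrite -quotientGI // tiAe quotient1.
rewrite !orderE eqe; apply/esym/card_isog/quotient_isog => //.
by apply/trivgP; rewrite -tiAe setSI.
Qed.

(** By the correspondence theorem, passing to [G / K] reduces this to subgroups that meet [A / K]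
    trivially. *)
Lemma sum_subgroups_meet (V : nmodType) (gT : finGroupType) (p l : nat)
    (G A K : {group gT}) (e : gT) (f : nat -> V) :
    prime p -> abelian G -> #[e] = (p ^ l)%N -> A \x <[e]> = G ->
    K \subset A ->
  (\sum_(H in subgroups G | (H :&: A)%G == K) f #|H|
   = \sum_(y in (A / K)%g) \sum_(i < l.+1 | (#[y] %| p ^ i)%N)
       f (#|K| * p ^ i)%N)%R.
Proof.
move=> p_pr abG oe defG sKA.
have sAG : A \subset G by case/dprodP: defG => _ <- _ _; apply: mulG_subl.
have nKG : K <| G by rewrite -sub_abelian_normal // (subset_trans sKA).
have [defGK oeK] := quotient_dprod_cycle abG defG sKA; rewrite oe in oeK.
rewrite -(sum_subgroups_trivial_meet (fun n => f (#|K| * n)%N) p_pr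
            (quotient_abelian _ abG) oeK defGK).
rewrite (reindex_onto (fun H' : {group coset_of K} => coset K @*^-1 H')%G
                      (fun H => H / K)%G) => [|H /andP[]]; last first.
  rewrite inE => sHG /eqP defK; apply/val_inj; rewrite /= quotientGK //.
  by rewrite -sub_abelian_normal ?(abelianS sHG) // -defK subsetIl.
apply: eq_big => [H|H _]; last by rewrite card_cosetpre.
rewrite !inE sub_cosetpre_quo //.
have -> : (coset K @*^-1 H / K)%G == H.
  by apply/eqP/val_inj; rewrite /= cosetpreK.
rewrite andbT; congr (_ && _); rewrite -val_eqE /=.
apply/eqP/eqP => [defK|tiHA].
  by rewrite -[in LHS](cosetpreK H) -quotientIG // defK trivg_quotient.
apply/eqP; rewrite eqEsubset subsetI sub_cosetpre sKA !andbT.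
have nKA : coset K @*^-1 H :&: A \subset 'N(K).
  exact: subset_trans (subsetIr _ _) (subset_trans sAG (normal_norm nKG)).
by rewrite -quotient_sub1 // quotientIG // cosetpreK tiHA.
Qed.

Lemma sum_subgroups_dprod_cycle (V : nmodType) (gT : finGroupType) (p l : nat)
    (G A : {group gT}) (e : gT) (f : nat -> V) :
    prime p -> abelian G -> #[e] = (p ^ l)%N -> A \x <[e]> = G ->
  (\sum_(H in subgroups G) f #|H|
   = \sum_(K in subgroups A) \sum_(y in (A / K)%g)
       \sum_(i < l.+1 | (#[y] %| p ^ i)%N) f (#|K| * p ^ i)%N)%R.
Proof.
move=> p_pr abG oe defG.
rewrite (partition_big (fun H => H :&: A)%G (mem (subgroups A))) /=.
  apply: eq_bigr => K; rewrite inE => sKA.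
  exact: (sum_subgroups_meet f p_pr abG oe defG sKA).
by move=> H _; rewrite inE subsetIr.
Qed.

Local Close Scope group_scope.
Local Open Scope ring_scope.
Local Open Scope complex_scope.

(** * Complex powers of natural numbers and a geometric sum *)

Lemma cexpD (R : realType) (z w : R[i]) : cexp (z + w) = cexp z * cexp w.
Proof.
case: z w => [a b] [c d]; rewrite /cexp /= expRD cosD sinD.
apply/eqP; rewrite eq_complex /=; apply/andP; split; apply/eqP; ring.
Qed.

Lemma cexp_natr (R : realType) (x : R[i]) (n : nat) :
  cexp (x * n%:R) = cexp x ^+ n.
Proof.
elim: n => [|n IHn]; last by rewrite -natr1 mulrDr mulr1 cexpD IHn exprSr.
rewrite mulr0 expr0 /cexp /= expR0 cos0 sin0.
by apply/eqP; rewrite eq_complex /= !mul1r !mul0r subr0 addr0 !eqxx.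
Qed.

Lemma natCpowD (R : realType) (n : nat) (a b : R[i]) :
  natCpow n (a + b) = natCpow n a * natCpow n b.
Proof. by rewrite /natCpow mulrDl cexpD. Qed.

Lemma natCpowM (R : realType) (m n : nat) (a : R[i]) :
  (0 < m)%N -> (0 < n)%N -> natCpow (m * n) a = natCpow m a * natCpow n a.
Proof.
move=> m0 n0; rewrite /natCpow natrM lnM ?qualifE/= ?ltr0n //.
by rewrite rmorphD mulrDr cexpD.
Qed.

Lemma natCpow_natr (R : realType) (n k : nat) (a : R[i]) :
  natCpow n (a * k%:R) = natCpow n a ^+ k.
Proof. by rewrite /natCpow mulrAC cexp_natr. Qed.

Lemma natCpowX (R : realType) (n k : nat) (a : R[i]) :
  (0 < n)%N -> natCpow (n ^ k) a = natCpow n a ^+ k.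
Proof.
move=> n0; rewrite /natCpow natrX lnXn ?ltr0n // -cexp_natr.
by rewrite rmorphMn [in LHS]mulrnAr mulr_natr.
Qed.

Lemma natCpow1 (R : realType) (n : nat) :
  (0 < n)%N -> natCpow n 1 = n%:R :> R[i].
Proof.
move=> n0; rewrite /natCpow mul1r /cexp /= lnK ?qualifE/= ?ltr0n //.
rewrite cos0 sin0 -[RHS]mulr1 -(rmorph_nat (real_complex R)).
by apply/eqP; rewrite eq_complex /= !(mulr0, mulr1, mul0r, subr0, addr0, eqxx).
Qed.

(** Divisibility means [j <= i], so the sum is the difference of two initial geometric sums. *)
Lemma sum_geometric_pfactor (R : nzRingType) (p l j : nat) (x : R) :
    (1 < p)%N -> (j <= l)%N ->
  (x - 1) * (\sum_(i < l.+1 | (p ^ j %| p ^ i)%N) x ^+ i) = x ^+ l.+1 - x ^+ j.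
Proof.
move=> p_gt1 le_jl.
transitivity ((x - 1) * (\sum_(i < l.+1) x ^+ i - \sum_(i < j) x ^+ i)).
  congr (_ * _); apply/eqP; rewrite eq_sym subr_eq addrC; apply/eqP.
  rewrite (bigID (fun i : 'I_l.+1 => (i < j)%N)) /=; congr (_ + _).
    by rewrite (big_ord_widen _ _ (leqW le_jl)).
  by apply: eq_bigl => i; rewrite -leqNgt dvdn_Pexp2l.
by rewrite mulrBr -!subrX1 opprB addrA subrK.
Qed.

Local Close Scope complex_scope.
Local Close Scope ring_scope.

Theorem theorem3p1 (R : realType) (p : nat) (p_prime : prime p) (a : R[i])
    (gT : finGroupType) (F F' : {group gT}) (r l : nat) (e : gT)
    (F_abelian : abelian F) (F_pgroup : (p.-group F)%g)
    (F_rank : ('r(F))%g = r) (r_ge1 : (1 <= r)%N)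
    (F_exponent : exponent F = (p ^ l)%N)
    (e_in_F : e \in F) (e_order : #[e]%g = (p ^ l)%N)
    (F'_sub_F : F' \subset F) (F_decomp : (F' \x <[e]>)%g = F) :
  ((natCpow p a - 1) * sigma a F =
    natCpow p (a * l%:R + a) * #|F'|%:R * sigma (a - 1) F'
      - sigma (a + 1) F')%R.
Proof.
have p_gt0 := prime_gt0 p_prime.
set x := natCpow p a.
have abF' : abelian F' := abelianS F'_sub_F F_abelian.
rewrite {1}/sigma (sum_subgroups_dprod_cycle (fun n => natCpow n a) p_prime
          F_abelian e_order F_decomp) mulr_sumr.
(* With [#[y] = p ^ j], the geometric sum gives [x ^+ l.+1 - x ^+ j], and [x ^+ j] is the [a]-th
   power of [#[y]]. *)
transitivity (\sum_(K in subgroups F')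
    ((\sum_(y in (F' / K)%g) natCpow #|K| a * x ^+ l.+1)
     - \sum_(y in (F' / K)%g) natCpow (#|K| * #[y]%g) a))%R.
  apply: eq_bigr => K; rewrite inE => sKF'.
  rewrite mulr_sumr -sumrB; apply: eq_bigr => y F'y.
  have : (#[y]%g %| p ^ l)%N.
    rewrite -F_exponent; apply: dvdn_trans (dvdn_exponent F'y) _.
    apply: dvdn_trans (exponent_quotient _ _) _.
    exact: exponentS.
  case/(dvdn_pfactor _ _ p_prime) => j le_jl oy.
  rewrite oy natCpowM ?cardG_gt0 ?expn_gt0 ?p_gt0 // natCpowX // -/x -mulrBr.
  rewrite -(sum_geometric_pfactor x (prime_gt1 p_prime) le_jl) mulrCA.
  congr (_ * _)%R; rewrite mulr_sumr; apply: eq_bigr => i _.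
  by rewrite natCpowM ?cardG_gt0 ?expn_gt0 ?p_gt0 // natCpowX.
rewrite sumrB (sum_subgroups_quotient (fun n => natCpow n a) abF').
congr (_ - _)%R; last first.
  by apply: eq_bigr => L _; rewrite natCpowD natCpow1 ?cardG_gt0 // mulr_natr.
rewrite mulr_sumr; apply: eq_bigr => K; rewrite inE => sKF'.
have nKF' : F' \subset 'N(K)%g by rewrite sub_abelian_norm.
rewrite sumr_const (natCpowD p) natCpow_natr -/x -exprSr.
(* The split-off factor [#|K|] combines with the number [#|F' : K|] of elements [y] into [#|F'|],
   independent of [K]. *)
have -> : natCpow #|K| a = (natCpow #|K| (a - 1) * #|K|%:R)%R.
  by rewrite -natCpow1 ?cardG_gt0 // -natCpowD subrK.
rewrite card_quotient // -(Lagrange sKF') natrM -mulr_natr.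
by ring.
Qed.
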